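(* Suppose that there is a constant $C_L$ with $|F(x)-F(x')|\le C_L|x-x'|$ for all $x,x'\in\mathbb{R}$, where $F$ is the cumulative distribution function of $X$. Suppose that for each level $\ell=0,1,2,\ldots$ the approximation $X_\ell$ is computed by the selective refinement algorithm described in the context, and that for every $\ell$ it satisfies $$|X-X_\ell|\le\gamma^\ell\quad\text{or}\quad |X-X_\ell|<|X_\ell-y| .$$ Let $Q_\ell=\mathbb{1}(X_\ell\le y)$. Then there is a constant $C$, independent of $\epsilon$, such that for every $0<\epsilon<e^{-1}$ there exist a level $L$ and a sequence of positive integers $\{N_\ell\}_{\ell=0}^L$ (both may depend on $\epsilon$) such that the multilevel Monte Carlo estimator $\widehat Q^{ML}_{\{N_\ell\},L}$ has root mean square error $e[\widehat Q^{ML}_{\{N_\ell\},L}]$ less than $\epsilon$, and its expected cost satisfies $$\mathcal{C}\left[\widehat Q^{ML}_{\{N_\ell\},L}\right]\le C\cdot\begin{cases}\epsilon^{-2} & \text{if } q<2,\\ \epsilon^{-2}(\log\epsilon^{-1})^2 & \text{if } q=2,\\ \epsilon^{-q} & \text{if } q>2.\end{cases}$$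
   Context: Let $(\Omega,P)$ be a probability space, $X=X(\omega)$ a real random variable (the quantity of interest) with cumulative distribution function $F$, $y\in\mathbb{R}$ a fixed critical value, and $Q=\mathbb{1}(X\le y)$, so that $\mathbb{E}[Q]=F(y)$ is the failure probability. Fix $0<\gamma<1$. $\mathbb{E}$ and $\mathbb{V}$ denote expectation and variance. Solver and cost model. For each $j=0,1,2,\ldots$ there is a computable real random variable $X^{(j)}=X^{(j)}(\omega)$, the result of ''computing $X$ to tolerance $\gamma^j$'', with $|X(\omega)-X^{(j)}(\omega)|\le\gamma^j$ for all $\omega$. Computing $X^{(j)}(\omega)$ for one realization $\omega$ costs $\gamma^{-qj}$, where $q$ is a fixed real number. Selective refinement algorithm (input: level $\ell$, realization $\omega$). Compute $X^{(0)}(\omega)$ and set $j=0$. While $j<\ell$ and $\gamma^j\ge|X^{(j)}(\omega)-y|$: replace $j$ by $j+1$ and compute $X^{(j)}(\omega)$. When the loop ends, output $X_\ell(\omega)=X^{(j)}(\omega)$ for the final value of $j$. The cost of the run is the sum of the costs of all the computations $X^{(0)}(\omega),\ldots,X^{(j)}(\omega)$ performed, and $\mathcal{C}[Q_\ell]$ is the expected value of this cost over $\omega$. Multilevel Monte Carlo estimator. With $Q_{-1}=0$ and mutually independent samples $\omega^i_\ell$ ($0\le\ell\le L$, $1\le i\le N_\ell$) distributed according to $P$, $$\widehat Q^{ML}_{\{N_\ell\},L}=\sum_{\ell=0}^L\frac1{N_\ell}\sum_{i=1}^{N_\ell}\left(Q_\ell(\omega^i_\ell)-Q_{\ell-1}(\omega^i_\ell)\right).$$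 Its expected cost is $\mathcal{C}[\widehat Q^{ML}_{\{N_\ell\},L}]=\sum_{\ell=0}^L N_\ell c_\ell$ with $c_\ell=\mathcal{C}[Q_\ell]+\mathcal{C}[Q_{\ell-1}]$ and $\mathcal{C}[Q_{-1}]=0$. The root mean square error of an estimator $\widehat Q$ of $\mathbb{E}[Q]$ is $e[\widehat Q]=\left(\mathbb{E}[(\widehat Q-\mathbb{E}[Q])^2]\right)^{1/2}$. *)

(* Defs.v *)
From HB Require Import structures.
From mathcomp Require Import all_boot all_order all_algebra.
From mathcomp Require Import all_classical all_reals all_analysis.

Set Implicit Arguments.
Unset Strict Implicit.
Unset Printing Implicit Defensive.

Import Order.TTheory GRing.Theory Num.Theory.

Local Open Scope classical_set_scope.
Local Open Scope ring_scope.

Definition failure (T : Type) (R : realType) (X : T -> R) (y : R) : T -> R :=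
  \1_[set w | X w <= y].

(** [Xs j w] is the result of computing the quantity of interest on [w] to
    tolerance [gamma ^+ j], at cost [gamma `^ (- (q * j))]. *)
Section selective_refinement.
Context (T : Type) (R : realType) (gamma q y : R) (Xs : nat -> T -> R).

(** One guarded execution of the body of the while loop. *)
Definition refine_step (l : nat) (w : T) (j : nat) : nat :=
  if (j < l)%N && (`|Xs j w - y| <= gamma ^+ j) then j.+1 else j.

(** Value of [j] when the loop ends: a round either increments [j], which never
    exceeds [l], or leaves it fixed forever, so that [l] rounds from [0] reach
    the exit of the loop. *)
Definition refine_final (l : nat) (w : T) : nat := iter l (refine_step l w) 0%N.

Definition refine_approx (l : nat) (w : T) : R := Xs (refine_final l w) w.

Definition refine_cost (l : nat) (w : T) : R :=
  \sum_(0 <= j < (refine_final l w).+1) gamma `^ (- (q * j%:R)).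

End selective_refinement.

Definition expected_refine_cost d (T : measurableType d) (R : realType)
    (P : probability T R) (gamma q y : R) (Xs : nat -> T -> R) (l : nat) :
    \bar R :=
  'E_P[refine_cost gamma q y Xs l].

(** [Q l - Q (l - 1)], with the convention [Q (-1) = 0]. *)
Definition level_difference (T : Type) (R : realType) (Q : nat -> T -> R)
    (l : nat) (w : T) : R :=
  if l is k.+1 then Q k.+1 w - Q k w else Q 0%N w.

(** [cQ l + cQ (l - 1)], with the convention [cQ (-1) = 0]. *)
Definition level_cost (R : realType) (cQ : nat -> \bar R) (l : nat) : \bar R :=
  if l is k.+1 then (cQ k.+1 + cQ k)%E else cQ 0%N.

Definition ml_cost (R : realType) (cQ : nat -> \bar R) (L : nat)
    (N : nat -> nat) : \bar R :=
  (\sum_(l < L.+1) (N l)%:R%:E * level_cost cQ l)%E.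

(** The sample [omega l i] drives both terms of the [l]-th difference. *)
Definition ml_estimator (T S : Type) (R : realType) (Q : nat -> T -> R)
    (L : nat) (N : nat -> nat) (omega : nat -> nat -> S -> T) (s : S) : R :=
  \sum_(l < L.+1) (N l)%:R^-1 *
    \sum_(i < N l) level_difference Q l (omega l i s).

Definition mutually_independent d d' (S : measurableType d)
    (T : measurableType d') (R : realType) (PS : probability S R)
    (I : finType) (Y : I -> S -> T) : Prop :=
  forall (J : {set I}) (A : I -> set T),
    (forall i, i \in J -> measurable (A i)) ->
    PS (\bigcap_(i in [set i | i \in J]) (Y i @^-1` A i)) =
    (\prod_(i in J) PS (Y i @^-1` A i))%E.

(** [omega l i], for [l <= L] and [i < N l], are mutually independent samples
    distributed according to [P]; the other [omega l i] are irrelevant. *)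
Definition ml_samples d d' (S : measurableType d) (T : measurableType d')
    (R : realType) (PS : probability S R) (P : probability T R)
    (L : nat) (N : nat -> nat) (omega : nat -> nat -> {mfun S >-> T}) : Prop :=
  (forall l i, (l <= L)%N -> (i < N l)%N ->
     forall A, measurable A -> distribution PS (omega l i) A = P A) /\
  mutually_independent PS
    (fun k : {l : 'I_L.+1 & 'I_(N l)} => omega (tag k) (tagged k) : S -> T).

Definition rmse d (S : measurableType d) (R : realType) (PS : probability S R)
    (Qhat : S -> R) (m : R) : \bar R :=
  sqrte 'E_PS[(fun s => (Qhat s - m) ^+ 2)].

Definition cost_rate (R : realType) (q eps : R) : R :=
  if q < 2 then eps ^- 2
  else if q == 2 then eps ^- 2 * ln eps^-1 ^+ 2
  else eps `^ (- q).

(* Main.v *)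
Require Import Defs.
From mathcomp Require Import all_boot all_order all_algebra.
From mathcomp Require Import all_classical all_reals all_analysis.
From mathcomp Require Import measurable_realfun ring lra.

(** A misclassification Q_l <> Q forces X to lie within gamma^l of y, and the
    (l+1)-st refinement is executed only if X lies within 2 gamma^l of y; since
    F is Lipschitz, both events have probability O(gamma^l).  Hence the bias and
    the second moments of the level differences are O(gamma^l), and a run of
    level l costs O(sum_(j <= l) gamma^(j (1 - q))) on average.  Independence
    makes the variances of the samples additive.  One takes the smallest L whose
    bias is below eps/2, so that gamma^(-L) = O(1/eps), and distributes a
    variance budget of eps^2/2 over the levels with weights w_l adapted to the
    sign of q - 2, i.e. N_l ~ eps^(-2) gamma^l / w_l. *)

Set Implicit Arguments.
Unset Strict Implicit.
Unset Printing Implicit Defensive.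

Import Order.TTheory GRing.Theory Num.Theory.

Local Open Scope classical_set_scope.
Local Open Scope ring_scope.

(** * Geometric sums *)

Lemma geometric_sum_le (R : realFieldType) (t : R) (n : nat) :
  0 <= t -> t < 1 -> \sum_(i < n) t ^+ i <= (1 - t)^-1.
Proof.
move=> t0 t1; rewrite -[leRHS]mulr1 ler_pdivlMl ?subr_gt0//.
by rewrite -[X in X * _]opprB mulNr -subrX1 opprB gerBl exprn_ge0.
Qed.

Lemma geometric_sum_rev_le (R : realFieldType) (t : R) (n : nat) :
  0 <= t -> t < 1 -> \sum_(i < n.+1) t ^+ (n - i) <= (1 - t)^-1.
Proof.
move=> t0 t1; rewrite (reindex_inj rev_ord_inj)/=.
under eq_bigr => i _ do rewrite subSS subKn ?leq_ord//.
exact: geometric_sum_le.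
Qed.

(** Dominated by its last term: divided by [r ^+ n] and read from the top, the sum is geometric with
    ratio [r^-1 < 1]. *)
Lemma geometric_sum_gt1_le (R : realFieldType) (r : R) (n : nat) :
  1 < r -> \sum_(i < n.+1) r ^+ i <= (1 - r^-1)^-1 * r ^+ n.
Proof.
move=> r1; have r0 : 0 < r by exact: lt_trans r1.
have -> : \sum_(i < n.+1) r ^+ i = (\sum_(i < n.+1) r^-1 ^+ (n - i)) * r ^+ n.
  rewrite mulr_suml; apply: eq_bigr => i _.
  have -> : r ^+ n = r ^+ (n - i) * r ^+ i by rewrite -exprD subnK// -ltnS.
  by rewrite mulrA -exprMn mulVf ?gt_eqF// expr1n mul1r.
rewrite ler_wpM2r ?exprn_ge0 ?(ltW r0)//.
by apply: geometric_sum_rev_le; rewrite ?invr_ge0 ?ltW// invf_lt1.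
Qed.

(** * Deterministic choice of the finest level and of the sample sizes *)

(** Level [l] receives the share [w l] of the variance budget: [x l] samples turn the bound
    [K * gamma ^+ l] into exactly [w l * (eps ^+ 2 / 2)]. Rounding [x l] up adds at most one sample
    per level, which is the first sum in the cost bound. *)
Lemma sample_sizes_of_weights (R : realType) (gamma rho K eps : R) (L : nat)
    (w : nat -> R) :
  0 < gamma -> 0 < rho -> 0 < K -> 0 < eps ->
  (forall l, (l <= L)%N -> 0 < w l) -> \sum_(l < L.+1) w l <= 1 ->
  exists N : nat -> nat, [/\ forall l, (0 < N l)%N,
    \sum_(l < L.+1) K * gamma ^+ l / (N l)%:R <= eps ^+ 2 / 2 &
    \sum_(l < L.+1) (N l)%:R * (K * rho ^+ l) <=
    K * \sum_(l < L.+1) rho ^+ l +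
    2 * K ^+ 2 * (eps ^- 2 * \sum_(l < L.+1) (gamma * rho) ^+ l / w l)].
Proof.
move=> g0 r0 K0 e0 w0 w1; have e20 : 0 < eps ^+ 2 by rewrite exprn_gt0.
pose x l := 2 * K * eps ^- 2 * (gamma ^+ l / w l).
have x0 l : (l <= L)%N -> 0 < x l.
  by move=> lL; rewrite !mulr_gt0 ?invr_gt0 ?exprn_gt0 ?w0.
exists (fun l => (Num.truncn (x l)).+1); split => //.
- rewrite -[leRHS]mul1r; apply: le_trans (ler_wpM2r _ w1); last first.
    by rewrite divr_ge0// ltW.
  rewrite mulr_suml; apply: ler_sum => l _.
  have lL : (l <= L)%N by rewrite -ltnS.
  have wl := w0 _ lL; have gl : 0 < gamma ^+ l by rewrite exprn_gt0.
  have -> : w l * (eps ^+ 2 / 2) = K * gamma ^+ l / x l.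
    by rewrite /x; field; rewrite !gt_eqF.
  rewrite ler_wpM2l ?mulr_ge0 ?(ltW K0) ?(ltW gl)//.
  by rewrite lef_pV2 ?posrE ?x0// ltW// truncnS_gt.
- rewrite !mulr_sumr -big_split; apply: ler_sum => l _ /=.
  have lL : (l <= L)%N by rewrite -ltnS.
  have -> : K * rho ^+ l + 2 * K ^+ 2 * (eps ^- 2 * ((gamma * rho) ^+ l / w l))
     = (1 + x l) * (K * rho ^+ l).
    by rewrite /x exprMn; ring.
  rewrite ler_wpM2r ?mulr_ge0 ?exprn_ge0 ?(ltW r0) ?(ltW K0)//.
  by rewrite -natr1 addrC lerD2l truncn_le ltW ?x0.
Qed.

(** Minimality of [L] gives the second bound: level [L - 1] violates the first one, and passing from
    [L - 1] to [L] costs one factor [gamma]. *)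
Lemma accuracy_level (R : realType) (gamma K eps : R) :
  0 < gamma -> gamma < 1 -> 1 <= K -> 0 < eps -> eps < 1 ->
  exists L : nat, K * gamma ^+ L <= eps / 2 /\
    gamma^-1 ^+ L <= 2 * K / gamma / eps.
Proof.
move=> g0 g1 K1 e0 e1.
have K0 : 0 < K by exact: lt_le_trans K1.
have ex : exists L, K * gamma ^+ L <= eps / 2.
  have /cvgrPdist_le /(_ (eps / 2 / K)) : (gamma ^+ n @[n --> \oo] --> 0).
    by apply: cvg_expr; rewrite gtr0_norm.
  rewrite !divr_gt0// => /(_ isT)[n _ /(_ n (leqnn _))/=].
  rewrite sub0r normrN ger0_norm ?exprn_ge0 ?(ltW g0)// => h; exists n.
  by rewrite mulrC -ler_pdivlMr.
exists (ex_minn ex); case: ex_minnP => -[|L] hL min; split => //.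
  (* For [L = 0] there is no previous level, but [eps * gamma <= 1 <= 2 * K]. *)
  rewrite expr0 ler_pdivlMr// mul1r ler_pdivlMr//.
  by apply: le_trans (_ : 1 <= _); [rewrite mulr_ile1// ltW|lra].
have : ~~ (K * gamma ^+ L <= eps / 2).
  by apply/negP => /min; rewrite ltnn.
rewrite -ltNge => h; rewrite exprVn exprS ler_pdivlMr// mulrC.
rewrite ler_pdivrMr ?mulr_gt0 ?exprn_gt0//.
have -> : 2 * K / gamma * (gamma * gamma ^+ L) = 2 * (K * gamma ^+ L).
  by field; rewrite gt_eqF.
by rewrite mulrC -ler_pdivrMr// ltW.
Qed.

Lemma powR_lt1 (R : realType) (a x : R) : 0 < a -> a < 1 -> 0 < x -> a `^ x < 1.
Proof.
move=> a0 a1 x0; have <- : 1 `^ x = 1 :> R by rewrite powR1.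
by rewrite gt0_ltr_powR ?nnegrE ?ltW.
Qed.

(** The hypothesis on [L] raised to the power [r]. It turns growth in [L] into a rate in [eps], with
    [r = q - 1] for the rounding cost and [r = q - 2] for the regime [q > 2]. *)
Lemma exprn_powRN_le (R : realType) (gamma M eps r : R) (L : nat) :
  0 < gamma -> 0 < M -> 0 < eps -> 0 <= r ->
  gamma^-1 ^+ L <= M / eps ->
  (gamma `^ (- r)) ^+ L <= M `^ r * eps `^ (- r).
Proof.
move=> g0 M0 e0 r0 h.
have inv_powR (a : R) : 0 < a -> a `^ (- r) = a^-1 `^ r.
  by move=> a0; rewrite -powR_inv1 ?ltW// -powRrM mulN1r.
have ig0 : 0 <= gamma^-1 by rewrite invr_ge0 ltW.
rewrite !inv_powR// -powRM ?invr_ge0 ?(ltW M0) ?(ltW e0)//.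
rewrite -powR_mulrn ?powR_ge0// powRAC powR_mulrn//.
apply: ge0_ler_powR; rewrite ?nnegrE ?exprn_ge0//.
by rewrite divr_ge0 ?(ltW M0) ?(ltW e0).
Qed.

Lemma ln_inv_gt1 (R : realType) (eps : R) :
  0 < eps -> eps < expR (-1) -> 1 < ln eps^-1.
Proof.
move=> e0 e1; rewrite lnV ?posrE// ltrNr -(expRK (-1)).
by rewrite ltr_ln ?posrE ?expR_gt0.
Qed.

(** The left side is the order of the cost of rounding the sample sizes up; it is absorbed in all
    three regimes, at [q = 2] because the logarithm exceeds 1. *)
Lemma cost_rate_ge (R : realType) (q eps : R) :
  0 < eps -> eps < expR (-1) -> eps `^ (1 - q) <= cost_rate q eps.
Proof.
move=> e0 e1.
have elt1 : eps < 1 by apply: lt_trans e1 _; rewrite expR_lt1 oppr_lt0.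
have emon x x' : x' <= x -> eps `^ x <= eps `^ x'.
  by move=> h; apply: ger_powR => //; rewrite e0 ltW.
have e2 : eps ^- 2 = eps `^ (- 2) by rewrite powR_invn// ltW.
have L1 := ln_inv_gt1 e0 e1.
rewrite /cost_rate; case: ltP => q2; last case: eqP => q2'.
- by rewrite e2; apply: emon; lra.
- apply: le_trans (_ : eps ^- 2 <= _); first by rewrite e2; apply: emon; lra.
  by rewrite ler_peMr ?invr_ge0 ?exprn_ge0 ?(ltW e0)// exprn_ege1// ltW.
- by apply: emon; lra.
Qed.

(* Weights of the error budget eps^2/2 over the levels, where
   (gamma * gamma `^ (1 - q)) ^+ l is the order of variance times cost on
   level l: geometrically decreasing in l for q < 2, uniform for q = 2,
   geometrically increasing in l for q > 2. *)
Lemma level_weights (R : realType) (gamma q M : R) :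
  0 < gamma -> gamma < 1 -> 1 <= M ->
  exists C : R, 0 <= C /\ forall (eps : R) (L : nat),
    0 < eps -> eps < expR (-1) -> gamma^-1 ^+ L <= M / eps ->
    exists w : nat -> R, [/\ forall l, (l <= L)%N -> 0 < w l,
      \sum_(l < L.+1) w l <= 1 &
      eps ^- 2 * \sum_(l < L.+1) (gamma * gamma `^ (1 - q)) ^+ l / w l <=
      C * cost_rate q eps].
Proof.
move=> g0 g1 M1; have M0 : 0 < M by exact: lt_le_trans M1.
have -> : gamma * gamma `^ (1 - q) = gamma `^ (2 - q).
  rewrite -{1}(powRr1 (ltW g0)) -powRD; last by rewrite (gt_eqF g0) implybT.
  by congr (_ `^ _); lra.
have [q2|q2|q2] := ltgtP q 2.
(* Each weight is the square root [t ^+ l] of variance times cost, normalised by [1 - t]. The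
   quotients are again geometric of ratio [t], so normalisation and summation each give a factor
   [(1 - t)^-1]. *)
- pose t := gamma `^ ((2 - q) / 2).
  have t0 : 0 < t by exact: powR_gt0.
  have t1 : t < 1 by apply: powR_lt1 => //; lra.
  have t1' : 0 < 1 - t by rewrite subr_gt0.
  have -> : gamma `^ (2 - q) = t ^+ 2.
    by rewrite -powR_mulrn ?ltW// -powRrM; congr (_ `^ _); lra.
  exists ((1 - t) ^- 2); split=> [|eps L e0 e1 hL].
    by rewrite invr_ge0 exprn_ge0// ltW.
  exists (fun l => (1 - t) * t ^+ l); split=> [l _||].
  + by rewrite mulr_gt0 ?exprn_gt0.
  + by rewrite -mulr_sumr -ler_pdivlMl// mulr1 geometric_sum_le// ltW.
  + rewrite /cost_rate q2 [leRHS]mulrC.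
    rewrite ler_wpM2l ?invr_ge0 ?exprn_ge0 ?(ltW e0)//.
    rewrite (eq_bigr (fun i : 'I_L.+1 => (1 - t)^-1 * t ^+ i)) => [|i _].
      rewrite -mulr_sumr expr2 invfM ler_wpM2l ?invr_ge0 ?(ltW t1')//.
      by rewrite geometric_sum_le// ltW.
    by rewrite exprAC; field; rewrite !gt_eqF// exprn_gt0.
(* Now variance times cost is [t ^- 2] to the power [l], largest at [L], so the weights decay
   downwards from [L]. The quotients sum to at most [(1 - t) ^- 2] times the value at [L], which is
   of order [eps] to the power [2 - q]. *)
- pose t := gamma `^ ((q - 2) / 2).
  have t0 : 0 < t by exact: powR_gt0.
  have t1 : t < 1 by apply: powR_lt1 => //; lra.
  have t1' : 0 < 1 - t by rewrite subr_gt0.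
  have gt : gamma `^ (2 - q) = t ^- 2.
    by rewrite -powR_mulrn ?ltW// -powRrM -powRN; congr (_ `^ _); lra.
  exists ((1 - t) ^- 2 * M `^ (q - 2)); split=> [|eps L e0 e1 hL].
    by rewrite mulr_ge0 ?invr_ge0 ?exprn_ge0 ?powR_ge0// ltW.
  exists (fun l => (1 - t) * t ^+ (L - l)); split=> [l _||].
  + by rewrite mulr_gt0 ?exprn_gt0.
  + by rewrite -mulr_sumr -ler_pdivlMl// mulr1 geometric_sum_rev_le// ltW.
  + rewrite /cost_rate ltNge (ltW q2)/= gt_eqF//.
    have -> : eps `^ (- q) = eps ^- 2 * eps `^ (- (q - 2)).
      rewrite -powR_invn ?ltW// -powRD ?(gt_eqF e0) ?implybT//.
      by congr (_ `^ _); lra.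
    rewrite mulrCA ler_wpM2l ?invr_ge0 ?exprn_ge0 ?(ltW e0)// -mulrA.
    rewrite (eq_bigr (fun i : 'I_L.+1 =>
        (1 - t)^-1 * (t ^- 2) ^+ L * t ^+ (L - i))) => [|i _].
      rewrite -mulr_sumr -[(1 - t) ^- 2]exprVn [(1 - t)^-1 ^+ 2]expr2 -!mulrA.
      rewrite ler_wpM2l ?invr_ge0 ?(ltW t1')//.
      rewrite mulrC ler_pM ?exprn_ge0 ?invr_ge0 ?sumr_ge0 ?(ltW t0)//.
      * by move=> i _; rewrite exprn_ge0 ?(ltW t0).
      * by rewrite exprn_ge0 ?(ltW t0).
      * by rewrite geometric_sum_rev_le// ltW.
      * rewrite -gt -(opprB q 2).
        by apply: exprn_powRN_le; rewrite // subr_ge0 ltW.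
    have -> : (t ^- 2) ^+ L = (t ^- 2) ^+ (L - i) * (t ^- 2) ^+ i.
      by rewrite -exprD subnK ?leq_ord.
    have h : (t ^- 2) ^+ (L - i) = t ^- (L - i) * t ^- (L - i).
      by rewrite exprVn expr2 exprMn invfM.
    by rewrite gt h; field; rewrite !gt_eqF// ?exprn_gt0.
- rewrite q2 subrr powRr0; have lg : 0 < ln gamma^-1.
    by rewrite ln_gt0// invf_gt1.
  (* With uniform weights the sum is the square of [L.+1], so [c] must satisfy
     [L.+1 <= c * ln eps^-1]. Taking logarithms in [hL] bounds [L]; as [ln eps^-1 > 1], the
     constants [ln M] and 1 are absorbed into multiples of it. *)
  pose c := (ln M + 1) / ln gamma^-1 + 1.
  have lM : 0 <= ln M by exact: ln_ge0.
  have c0 : 0 <= c by rewrite addr_ge0// divr_ge0 ?addr_ge0// ltW.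
  exists (c ^+ 2); split=> [|eps L e0 e1 hL]; first exact: exprn_ge0.
  have n0 : 0 < L.+1%:R :> R by [].
  exists (fun=> L.+1%:R^-1); split=> [l _||].
  + by rewrite invr_gt0.
  + by rewrite sumr_const card_ord -[leLHS]mulr_natr mulVf ?gt_eqF.
  + rewrite /cost_rate ltxx eqxx mulrCA.
    rewrite ler_wpM2l ?invr_ge0 ?exprn_ge0 ?(ltW e0)//.
    under eq_bigr do rewrite expr1n mul1r invrK.
    rewrite sumr_const card_ord -[leLHS]mulr_natr -expr2 -exprMn.
    have l1 := ltW (ln_inv_gt1 e0 e1).
    rewrite ler_sqr ?nnegrE// ?mulr_ge0//; last exact: le_trans l1.
    have : L%:R * ln gamma^-1 <= ln M + ln eps^-1.
      rewrite -lnM ?posrE ?invr_gt0// mulr_natl -lnXn ?invr_gt0//.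
      by rewrite ler_ln ?posrE ?exprn_gt0 ?mulr_gt0 ?invr_gt0.
    rewrite -ler_pdivlMr// => hL'.
    rewrite -natr1 /c mulrDl mul1r lerD// (le_trans hL')//.
    rewrite [leRHS]mulrAC ler_wpM2r ?invr_ge0 ?(ltW lg)//.
    by rewrite mulrDl mul1r lerD2r ler_peMr.
Qed.

(** Since [1 < q], the cost ratio [rho] exceeds 1 and the rounding cost is governed by its last
    term, of order [rho ^+ L]. The two summands of the constant pay for rounding and for the
    weighted budget. *)
Lemma sample_sizes (R : realType) (gamma q K : R) :
  0 < gamma -> gamma < 1 -> 1 < q -> 1 <= K ->
  exists C : R, forall eps : R, 0 < eps -> eps < expR (-1) ->
    exists (L : nat) (N : nat -> nat), [/\ forall l, (0 < N l)%N,
      K * gamma ^+ L <= eps / 2,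
      \sum_(l < L.+1) K * gamma ^+ l / (N l)%:R <= eps ^+ 2 / 2 &
      \sum_(l < L.+1) (N l)%:R * (K * (gamma `^ (1 - q)) ^+ l) <=
      C * cost_rate q eps].
Proof.
move=> g0 g1 q1 K1; have K0 : 0 < K by exact: lt_le_trans K1.
pose M := 2 * K / gamma; pose rho := gamma `^ (1 - q).
have M1 : 1 <= M by rewrite ler_pdivlMr// mul1r (le_trans (ltW g1))//; lra.
have rho1 : 1 < rho.
  rewrite /rho -opprB powRN -invf_lt1 ?invrK ?invr_gt0 ?powR_gt0//.
  by rewrite powR_lt1// subr_gt0.
have rho0 : 0 < rho by exact: lt_trans rho1.
have d0 : 0 <= (1 - rho^-1)^-1 by rewrite invr_ge0 subr_ge0 invf_le1// ltW.
have [C2 [C20 hC2]] := level_weights q g0 g1 M1.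
exists (K * ((1 - rho^-1)^-1 * M `^ (q - 1)) + 2 * K ^+ 2 * C2) => eps e0 e1.
have elt1 : eps < 1 by apply: lt_trans e1 _; rewrite expR_lt1 oppr_lt0.
have [L [KL gL]] := accuracy_level g0 g1 K1 e0 elt1.
have [w [w0 w1 hw]] := hC2 _ _ e0 e1 gL.
have [N [N0 hN1 hN2]] := sample_sizes_of_weights g0 rho0 K0 e0 w0 w1.
exists L, N; split => //; apply: le_trans hN2 _; rewrite [leRHS]mulrDl lerD//.
- rewrite -!mulrA ler_wpM2l ?(ltW K0)//.
  apply: le_trans (geometric_sum_gt1_le _ rho1) _; rewrite ler_wpM2l//.
  have := exprn_powRN_le g0 (lt_le_trans ltr01 M1) e0 _ gL.
  move=> /(_ (q - 1)); rewrite subr_ge0 (ltW q1) opprB => /(_ isT) h.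
  apply: le_trans h _; rewrite ler_wpM2l ?powR_ge0//.
  exact: cost_rate_ge.
- by rewrite -[leRHS]mulrA ler_wpM2l// mulr_ge0// exprn_ge0// ltW.
Qed.

(** * Second moments, covariances and expectations *)

Lemma Lfun2_indic d (T : measurableType d) (R : realType)
    (P : probability T R) (A : set T) :
  measurable A -> (\1_A : T -> R) \in Lfun P 2%:E.
Proof.
move=> mA; rewrite inE/=; apply/andP; split; rewrite inE/=.
  exact: measurable_indic.
rewrite /finite_norm unlock poweR_lty//.
under eq_integral => x _ /=.
  have -> : (`|\1_A x : R| `^ 2)%R = (\1_A x)%R.
    by rewrite indicE; case: (x \in A); rewrite ?normr1 ?normr0 ?powR1 ?powR0.
  over.
by rewrite integral_indic// setIT ltey_eq fin_num_measure.
Qed.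

Lemma covariance_indic_indep d (T : measurableType d) (R : realType)
    (P : probability T R) (A B : set T) :
  measurable A -> measurable B -> P (A `&` B) = (P A * P B)%E ->
  covariance P (\1_A) (\1_B) = 0%E.
Proof.
move=> mA mB AB; have Pfin : P setT \is a fin_num by exact: fin_num_measure.
have [LA LB] := (Lfun2_indic P mA, Lfun2_indic P mB).
rewrite covarianceE ?(Lfun2_mul_Lfun1 LA LB) ?(Lfun_subset12 Pfin)//.
have -> : (\1_A * \1_B)%R = \1_(A `&` B) :> (T -> R) by rewrite indicI.
rewrite !expectation_indic//; last exact: measurableI.
by rewrite AB subee// fin_numM// fin_num_measure.
Qed.

Lemma variance_sum_uncorrelated d (T : measurableType d) (R : realType)
    (P : probability T R) (I : eqType) (r : seq I) (Z : I -> T -> R) :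
  uniq r -> (forall i, Z i \in Lfun P 2%:E) ->
  (forall i j, i != j -> covariance P (Z i) (Z j) = 0%E) ->
  'V_P[\sum_(i <- r) Z i] = (\sum_(i <- r) 'V_P[Z i])%E.
Proof.
move=> + LZ cZ; elim: r => [|i r IH] /=; first by rewrite !big_nil variance_cst.
move=> /andP[ir ur]; rewrite !big_cons.
have Lsum (s : seq I) : \sum_(j <- s) Z j \in Lfun P 2%:E.
  by elim: s => [|j s Hs]; rewrite ?big_nil ?big_cons ?Lfun_cst// rpredD ?lee1n.
have -> : Z i + \sum_(j <- r) Z j = Z i \+ \sum_(j <- r) Z j by [].
rewrite varianceD// IH// [X in (_ * X)%E](_ : _ = 0%E) ?mule0 ?adde0//.
(* The head is uncorrelated with the sum of the tail, by additivity of the covariance. *)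
elim: r ir {IH ur} => [|j r IH]; first by rewrite big_nil covariance_cst_r.
rewrite inE negb_or big_cons => /andP[ij ir].
have -> : Z j + \sum_(k <- r) Z k = Z j \+ \sum_(k <- r) Z k by [].
by rewrite covarianceDr// cZ// add0e IH.
Qed.

Lemma expectation_big_sum d (T : measurableType d) (R : realType)
    (P : probability T R) (I : eqType) (r : seq I) (Z : I -> T -> R) :
  (forall i, Z i \in Lfun P 1) ->
  'E_P[\sum_(i <- r) Z i]%E = (\sum_(i <- r) 'E_P[Z i])%E.
Proof.
move=> LZ; have := @expectation_sum _ _ _ P [seq Z i | i <- r].
by rewrite !big_map; apply => _ /mapP[i _ ->].
Qed.

(** Bias-variance decomposition: subtracting the constant [m] leaves the variance unchanged and
    shifts the mean. *)
Lemma expectation_sqr_error d (T : measurableType d) (R : realType)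
    (P : probability T R) (f : T -> R) (m : R) : f \in Lfun P 2%:E ->
  'E_P[(fun w => (f w - m) ^+ 2)%R]%E =
  ('V_P[f] + ((fine 'E_P[f] - m) ^+ 2)%:E)%E.
Proof.
move=> Lf; have Pfin : P setT \is a fin_num by exact: fin_num_measure.
have Lm : f \- cst m \in Lfun P 2%:E.
  by rewrite rpredB ?lee1n//= => _; rewrite Lfun_cst.
have L1 := Lfun_subset12 Pfin Lf.
rewrite -(varianceB_cst_r m Lf) varianceE//.
have -> : 'E_P[f \- cst m]%E = (fine 'E_P[f] - m)%:E.
  rewrite expectationB ?Lfun_cst// expectation_cst EFinB.
  by rewrite fineK ?expectation_fin_num.
by rewrite -EFin_expe subeK.
Qed.

(** * Independence and the mean square error of the multilevel estimator *)

Lemma mutually_independent_pair d d' (S : measurableType d)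
    (T : measurableType d') (R : realType) (PS : probability S R)
    (I : finType) (Y : I -> S -> T) (i j : I) (A B : set T) :
  mutually_independent PS Y -> i != j -> measurable A -> measurable B ->
  PS (Y i @^-1` A `&` Y j @^-1` B) = (PS (Y i @^-1` A) * PS (Y j @^-1` B))%E.
Proof.
move=> ind ij mA mB; pose F k := if k == i then A else B.
have Fi : F i = A by rewrite /F eqxx.
have Fj : F j = B by rewrite /F eq_sym (negbTE ij).
have := ind [set i; j]%SET F.
rewrite big_setU1 ?inE//= big_set1 Fi Fj => <-; last first.
  by move=> k; rewrite !inE => /orP[] /eqP ->; rewrite ?Fi ?Fj.
congr (PS _); apply/seteqP; split => [w [wA wB] k /=|w h].
  by rewrite !inE => /orP[] /eqP ->; rewrite ?Fi ?Fj.
by split; [have := h i|have := h j]; rewrite /= !inE eqxx ?orbT ?Fi ?Fj; apply.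
Qed.

Lemma sum_tag_ord (V : nmodType) (L : nat) (N : nat -> nat) (F : nat -> V) :
  \sum_(k : {l : 'I_L & 'I_(N l)}) F (tag k) = \sum_(l < L) F l *+ N l.
Proof.
under [RHS]eq_bigr => l _ do rewrite -[X in _ *+ X]card_ord -sumr_const.
by rewrite sig_big_dep.
Qed.

(** Here [A l] plays the event that level [l] reports failure, and [G l] contains the event that
    level [l] disagrees with the previous one. Written over all sample indices, the estimator is a
    sum of uncorrelated terms; each variance is at most a second moment, hence at most the
    probability of [G l] over [N l] squared. *)
Lemma ml_estimator_mse_le d d' (S : measurableType d) (T : measurableType d')
    (R : realType) (PS : probability S R) (P : probability T R)
    (A G : nat -> set T) (L : nat) (N : nat -> nat)
    (omega : nat -> nat -> {mfun S >-> T}) (m : R) :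
  (forall l, measurable (A l)) -> (forall l, measurable (G l)) ->
  (forall l w,
    level_difference (fun l => \1_(A l)) l w ^+ 2 <= \1_(G l) w :> R) ->
  (forall l, (l <= L)%N -> (0 < N l)%N) ->
  ml_samples PS P L N omega ->
  ('E_PS[(fun s => (ml_estimator (fun l => \1_(A l)) L N
      (fun l i => omega l i : S -> T) s - m) ^+ 2)%R] <=
   (\sum_(l < L.+1) fine (P (G l)) / (N l)%:R +
    (fine (P (A L)) - m) ^+ 2)%:E)%E.
Proof.
move=> mA mG DG N0 [dist ind].
have Pfin : PS setT \is a fin_num by exact: fin_num_measure.
(* The convention that level -1 reports 0 becomes the indicator of the empty set, so every level
   difference is a difference of two indicators. *)
pose A' l := if l is k.+1 then A k else set0.
have mA' l : measurable (A' l) by case: l => [|l] /=.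
have DE l w : level_difference (fun l => \1_(A l)) l w
    = \1_(A l) w - \1_(A' l) w :> R.
  by case: l => [|l] //=; rewrite indic0 subr0.
pose I := {l : 'I_L.+1 & 'I_(N l)}.
pose om (k : I) : {mfun S >-> T} := omega (tag k) (tagged k).
have mom (k : I) B : measurable B -> measurable (om k @^-1` B).
  by move=> mB; exact: measurable_funPTI.
have Pom (k : I) B : measurable B -> PS (om k @^-1` B) = P B.
  by move=> mB; rewrite -(dist (tag k) (tagged k)) ?leq_ord.
pose D (k : I) : S -> R :=
  \1_(om k @^-1` A (tag k)) \- \1_(om k @^-1` A' (tag k)).
have LD k : D k \in Lfun PS 2%:E.
  by rewrite rpredB ?lee1n//= => *; rewrite Lfun2_indic//; exact: mom.
pose c (k : I) : R := (N (tag k))%:R^-1.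
pose Z k := c k \o* D k.
have LZ k : Z k \in Lfun PS 2%:E by rewrite Lfun_scale ?ler1n.
have -> : ml_estimator (fun l => \1_(A l)) L N (fun l i => omega l i : S -> T)
    = \sum_k Z k.
  apply/funext => s; rewrite fct_sumE /ml_estimator.
  under eq_bigr do rewrite mulr_sumr.
  rewrite sig_big_dep; apply: eq_bigr => k _ /=.
  by rewrite DE mulrC.
(* By bilinearity only covariances of indicators of preimages under distinct samples remain, and
   such events are independent. *)
have cZ i j : i != j -> covariance PS (Z i) (Z j) = 0%E.
  move=> ij; have L1 k := Lfun_subset12 Pfin (LD k).
  have cI B C : measurable B -> measurable C ->
      covariance PS (\1_(om i @^-1` B)) (\1_(om j @^-1` C)) = 0%E.
    move=> mB mC; apply: covariance_indic_indep; try exact: mom.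
    exact: (mutually_independent_pair ind).
  have cD : covariance PS (D i) (D j) = 0%E.
    rewrite covarianceBl ?covarianceBr ?Lfun2_indic//; try exact: mom.
    by rewrite !cI// !sube0.
  rewrite covarianceZl//; [|exact: Lfun_subset12|exact: Lfun2_mul_Lfun1].
  by rewrite covarianceZr// ?cD ?mule0//; exact: Lfun2_mul_Lfun1.
have Lsum : \sum_k Z k \in Lfun PS 2%:E by rewrite rpred_sum// lee1n.
(* Telescoping over the levels leaves the finest one. *)
have PA n : \sum_(l < n.+1) (fine (P (A l)) - fine (P (A' l))) = fine (P (A n)).
  elim: n => [|n IH]; first by rewrite big_ord1 /= measure0 subr0.
  by rewrite big_ord_recr IH /= addrC subrK.
have EZ : 'E_PS[\sum_k Z k]%E = (fine (P (A L)))%:E.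
  rewrite expectation_big_sum => [|k]; last exact: Lfun_subset12.
  rewrite (eq_bigr (fun k : I =>
      (c k * (fine (P (A (tag k))) - fine (P (A' (tag k)))))%:E)) => [|k _].
    rewrite sumEFin -PA (sum_tag_ord L.+1 N
      (fun l => (N l)%:R^-1 * (fine (P (A l)) - fine (P (A' l))))).
    congr EFin; apply: eq_bigr => l _.
    rewrite -[LHS]mulr_natr; field.
    by rewrite pnatr_eq0 -lt0n N0// leq_ord.
  have [LA LA'] := (Lfun2_indic PS (mom k _ (mA (tag k))),
                    Lfun2_indic PS (mom k _ (mA' (tag k)))).
  rewrite expectationZl ?expectationB ?(Lfun_subset12 Pfin)//.
  rewrite !expectation_indic; [|exact: mom|exact: mom].
  by rewrite !Pom// EFinM EFinB !fineK ?fin_num_measure.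
rewrite expectation_sqr_error// EZ EFinD leeD2r//.
rewrite variance_sum_uncorrelated ?index_enum_uniq//.
have -> : (\sum_(l < L.+1) fine (P (G l)) / (N l)%:R)%:E =
    (\sum_k (c k ^+ 2 * fine (P (G (tag k))))%:E)%E.
  rewrite sumEFin (sum_tag_ord L.+1 N
    (fun l => (N l)%:R^-1 ^+ 2 * fine (P (G l)))).
  congr EFin; apply: eq_bigr => l _.
  rewrite /= -[RHS]mulr_natr; field.
  by rewrite pnatr_eq0 -lt0n N0// leq_ord.
apply: lee_sum => k _; rewrite varianceZ// [X in (_ <= X)%E]EFinM.
rewrite lee_wpmul2l ?lee_fin ?sqr_ge0//.
rewrite fineK ?fin_num_measure// varianceE//.
have fE : 'E_PS[D k]%E \is a fin_num by exact/expectation_fin_num/Lfun_subset12.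
(* The variance is bounded by the second moment, which [DG] controls pointwise. *)
apply: le_trans (_ : 'E_PS[D k ^+ 2] <= _)%E.
  by rewrite -(fineK fE) -EFin_expe leeBlDr// leeDl// lee_fin sqr_ge0.
rewrite -(Pom k)// -expectation_indic; last exact: mom.
apply: expectation_le.
- have mD : measurable_fun setT (D k).
    by apply: measurable_funB; apply: measurable_indic; exact: mom.
  exact: (measurable_funX 2%N mD).
- by apply: measurable_indic; exact: mom.
- by move=> s; exact: sqr_ge0.
- by move=> s.
- by apply: aeW => s; have := DG (tag k) (om k s); rewrite DE.
Qed.

(** * The refinement loop and its measurability *)

(** Proved as an invariant of the first [m <= l] rounds: the index advances by one per round until a
    test fails, and then stays. Events about the final index thereby become finite intersections of
    threshold events. *)
Lemma leq_refine_final (T : Type) (R : realType) (gamma y : R)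
    (Xs : nat -> T -> R) (l : nat) (w : T) (i : nat) :
  (i <= refine_final gamma y Xs l w)%N =
  (i <= l)%N && all (fun k => `|Xs k w - y| <= gamma ^+ k) (iota 0 i).
Proof.
pose cond k := `|Xs k w - y| <= gamma ^+ k.
suff inv m : (m <= l)%N ->
    forall i, (i <= iter m (refine_step gamma y Xs l w) 0%N)%N =
      (i <= m)%N && all cond (iota 0 i) by exact: inv.
elim: m => [|m IH] ml {}i; first by case: i.
have {}IH := IH (ltnW ml); rewrite iterS.
set j := iter m _ _ in IH *.
have jm : (j <= m)%N by have := IH j; rewrite leqnn => /esym/andP[].
have jc : all cond (iota 0 j) by have := IH j; rewrite leqnn => /esym/andP[].
rewrite /refine_step (leq_ltn_trans jm ml) /= -/(cond j).
have [cj|ncj] := boolP (cond j).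
  have [ij|ij] := leqP i j.+1.
    rewrite (leq_trans ij)//=; symmetry; apply/allP => k.
    rewrite mem_iota /= add0n => ki;
    have : (k <= j)%N by exact: leq_trans ki ij.
    rewrite leq_eqVlt => /predU1P[->//|kj].
    by apply: (allP jc); rewrite mem_iota.
  have [ji|//] := boolP (i <= m.+1)%N.
  (* If [j < m] with all tests up to [j] passed, the invariant at [j.+1] would have moved the index
     beyond [j]. *)
  have jm' : (j < m)%N by exact: leq_trans ij ji.
  by have := IH j.+1; rewrite ltnn jm' -addn1 iotaD all_cat jc /= add0n cj.
rewrite IH; have [ij|ij] := leqP i j.
  by rewrite (leq_trans ij jm) (leq_trans ij (leqW jm)).
suff -> : all cond (iota 0 i) = false by rewrite !andbF.
by apply: contraNF ncj => /allP; apply; rewrite mem_iota.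
Qed.

Lemma measurable_near d (T : measurableType d) (R : realType)
    (X : {mfun T >-> R}) (y a : R) :
  measurable [set w | `|X w - y| <= a].
Proof.
have mf : measurable_fun setT (fun w => `|X w - y|).
  by apply: measurableT_comp => //; apply: measurable_funB.
rewrite -[X in measurable X]setTI; have := mf measurableT `]-oo, a]%classic.
by rewrite set_itvNyc; apply; rewrite -set_itvNyc.
Qed.

Section refinement_sets.
Context d (T : measurableType d) (R : realType) (P : probability T R)
  (gamma y : R) (Xs : nat -> {RV P >-> R}).
Let Xf := (fun j => Xs j : T -> R).

Lemma measurable_refine_final_ge (l i : nat) :
  measurable [set w | (i <= refine_final gamma y Xf l w)%N].
Proof.
have -> : [set w | (i <= refine_final gamma y Xf l w)%N] =
    [set w | (i <= l)%N] `&`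
    \bigcap_(k in `I_i) [set w | `|Xs k w - y| <= gamma ^+ k].
  apply/seteqP; split=> [w /=|w [/= il h]]; rewrite leq_refine_final.
    move=> /andP[il /allP h]; split => // k /= ki.
    by apply: h; rewrite mem_iota.
  apply/andP; split=> //; apply/allP => k; rewrite mem_iota /= => ki.
  exact: h.
apply: measurableI.
  case: (i <= l)%N.
    by rewrite [X in measurable X](_ : _ = setT)//; apply/seteqP; split.
  by rewrite [X in measurable X](_ : _ = set0)//; apply/seteqP; split.
apply: bigcap_measurableType => k _.
exact: measurable_near.
Qed.

(** Split by the final index: where it equals [j], the output is [Xs j]. *)
Lemma measurable_refine_approx_le (l : nat) :
  measurable [set w | refine_approx gamma y Xf l w <= y].
Proof.
have -> : [set w | refine_approx gamma y Xf l w <= y] =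
    \bigcup_j (([set w | (j <= refine_final gamma y Xf l w)%N] `\`
               [set w | (j.+1 <= refine_final gamma y Xf l w)%N]) `&`
               (Xs j @^-1` `]-oo, y])).
  apply/seteqP; split=> [w /= h|w [j _ [[/= h1 /negP h2]]]].
    exists (refine_final gamma y Xf l w) => //.
    split; last by rewrite /= in_itv.
    by split => /=; rewrite ?ltnn.
  rewrite /= in_itv /= /refine_approx.
  have -> // : refine_final gamma y Xf l w = j.
  by apply/eqP; rewrite eqn_leq h1 andbT leqNgt.
apply: bigcup_measurable => j _.
apply: measurableI; last exact: measurable_funPTI.
by apply: measurableD; exact: measurable_refine_final_ge.
Qed.

End refinement_sets.

(** * Probability of being near the critical value, and expected cost of a run *)

(** A difference of values of the cdf measures a half-open interval, which would miss the left
    endpoint [y - a]. The closed interval is therefore enlarged to start at [y - 2 * a], whence the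
    factor 3. *)
Lemma probability_near_le d (T : measurableType d) (R : realType)
    (P : probability T R) (X : {RV P >-> R}) (C_L y a : R) :
  (forall x x' : R, (`|cdf X x - cdf X x'| <= (C_L * `|x - x'|)%:E)%E) ->
  0 < a -> (P [set w | (`|X w - y| <= a)%R] <= (3 * C_L * a)%:E)%E.
Proof.
move=> lip a0; have mitv x : measurable (X @^-1` `]-oo, x]).
  exact: measurable_funPTI.
have itv_le u v : u <= v -> X @^-1` `]-oo, u] `<=` X @^-1` `]-oo, v].
  by move=> uv w /=; rewrite !in_itv /= => /le_trans; apply.
apply: (@le_trans _ _
  (P (X @^-1` `]-oo, y + a] `\` X @^-1` `]-oo, (y - 2 * a)]))).
  apply: le_measure; rewrite ?inE.
  - exact: measurable_near.
  - exact: measurableD.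
  - move=> w /=; rewrite ler_norml !in_itv /= => /andP[h1 h2].
    by split; [lra|apply/negP; rewrite -ltNge; lra].
rewrite measureD//; last by rewrite -ge0_fin_numE ?fin_num_measure.
rewrite setIidr; last by apply: itv_le; lra.
apply: (le_trans (lee_abs _)); apply: (le_trans (lip (y + a) (y - 2 * a))).
rewrite lee_fin (_ : y + a - (y - 2 * a) = 3 * a); last by ring.
by rewrite ger0_norm ?mulr_ge0 ?(ltW a0)// mulrCA mulrA.
Qed.

(** The [j]-th computation is paid for exactly when the index reaches [j], so the cost is a
    combination of indicators over a fixed range. *)
Lemma expected_refine_costE d (T : measurableType d) (R : realType)
    (P : probability T R) (gamma q y : R) (Xs : nat -> {RV P >-> R}) (l : nat) :
  expected_refine_cost P gamma q y (fun j => Xs j : T -> R) l =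
  (\sum_(j < l.+1) (gamma `^ (- (q * j%:R)))%:E * P [set w |
     (j <= refine_final gamma y (fun j => Xs j : T -> R) l w)%N])%E.
Proof.
pose final := refine_final gamma y (fun j => Xs j : T -> R) l.
have Pfin : P setT \is a fin_num by exact: fin_num_measure.
have mD (j : 'I_l.+1) : measurable [set w | (j <= final w)%N].
  exact: measurable_refine_final_ge.
have LD (j : 'I_l.+1) :
    (\1_[set w | (j <= final w)%N] : T -> R) \in Lfun P 1.
  by apply: (Lfun_subset12 Pfin); exact: (Lfun2_indic P (mD j)).
pose Z (j : 'I_l.+1) : T -> R :=
  gamma `^ (- (q * j%:R)) \o* \1_[set w | (j <= final w)%N].
have -> : expected_refine_cost P gamma q y (fun j => Xs j : T -> R) l =
    'E_P[\sum_j Z j]%E.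
  rewrite /expected_refine_cost; congr ('E_P[_])%E; apply/funext => w.
  rewrite fct_sumE /refine_cost -/(final w).
  have fl : (final w <= l)%N.
    by have := leqnn (final w); rewrite leq_refine_final => /andP[].
  rewrite (big_nat_widen _ _ l.+1)//= big_mkcond big_mkord.
  apply: eq_bigr => j _.
 rewrite /Z /= indicE ltnS.
  have -> : (w \in [set w | (j <= final w)%N]) = (j <= final w)%N.
    by apply/idP/idP => [/set_mem|/mem_set].
  by case: (j <= final w)%N; rewrite ?mul1r ?mul0r.
rewrite expectation_big_sum => [|j]; last by rewrite Lfun_scale ?LD ?lexx.
by apply: eq_bigr => j _; rewrite expectationZl// expectation_indic.
Qed.

(** Reaching [j.+1] means that test [j] passed, so [X] is within [2 * gamma ^+ j] of [y]; this has
    probability at most [6 * C_L / gamma * gamma ^+ j.+1]. Multiplying by the cost of a computation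
    gives the ratio of the geometric sum. *)
Lemma expected_refine_cost_le d (T : measurableType d) (R : realType)
    (P : probability T R) (X : {RV P >-> R}) (y gamma q q' : R)
    (Xs : nat -> {RV P >-> R}) (C_L : R) (l : nat) :
  0 < gamma -> gamma < 1 -> q <= q' ->
  (forall j w, `|X w - Xs j w| <= gamma ^+ j) ->
  (forall x x' : R, (`|cdf X x - cdf X x'| <= (C_L * `|x - x'|)%:E)%E) ->
  0 <= C_L ->
  (expected_refine_cost P gamma q y (fun j => Xs j : T -> R) l <=
   ((1 + 6 * C_L / gamma) * \sum_(j < l.+1) (gamma `^ (1 - q')) ^+ j)%:E)%E.
Proof.
move=> g0 g1 qq' hX lip C0; rewrite expected_refine_costE mulr_sumr -sumEFin.
have K0 : 0 <= 6 * C_L / gamma by rewrite divr_ge0 ?mulr_ge0// ltW.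
apply: lee_sum => -[j /= _] _.
have PD :
    (P [set w | (j <= refine_final gamma y (fun j => Xs j : T -> R) l w)%N] <=
     ((1 + 6 * C_L / gamma) * gamma ^+ j)%:E)%E.
  (* The computation at [j = 0] is always performed; it accounts for the summand 1 of the
     constant. *)
  case: j => [|j].
    apply: le_trans (probability_le1 _ _) _.
      exact: measurable_refine_final_ge.
    by rewrite lee_fin expr0 mulr1 lerDl.
  have gj : 0 < gamma ^+ j by rewrite exprn_gt0.
  apply: (@le_trans _ _ (P [set w | `|X w - y| <= 2 * gamma ^+ j])).
    apply: le_measure; rewrite ?inE.
    - exact: measurable_refine_final_ge.
    - exact: measurable_near.
    - move=> w /=; rewrite leq_refine_final => /andP[_ /allP /(_ j)].
      rewrite mem_iota /= leqnn => /(_ isT) h.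
      rewrite (_ : X w - y = (X w - Xs j w) + (Xs j w - y)); last by ring.
      by apply: le_trans (ler_normD _ _) _; rewrite mulrDl mul1r lerD.
  apply: le_trans (probability_near_le _ lip _) _; first by rewrite mulr_gt0.
  rewrite lee_fin (_ : 3 * C_L * (2 * gamma ^+ j) =
      6 * C_L / gamma * gamma ^+ j.+1).
    by rewrite ler_wpM2r ?exprn_ge0 ?(ltW g0)// lerDr.
  by rewrite exprS; field; rewrite gt_eqF.
apply: (@le_trans _ _ ((gamma `^ (- (q' * j%:R)))%:E *
  ((1 + 6 * C_L / gamma) * gamma ^+ j)%:E)%E).
  apply: lee_pmul => //; rewrite lee_fin ?powR_ge0//.
  by apply: ger_powR; rewrite ?g0 ?(ltW g1)// lerN2 ler_wpM2r.
rewrite -EFinM lee_fin -mulNr powRrM powR_mulrn ?powR_ge0//.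
have -> : gamma `^ (1 - q') = gamma `^ (- q') * gamma.
  by rewrite addrC powRD ?(gt_eqF g0) ?implybT// powRr1// ltW.
by rewrite mulrCA exprMn.
Qed.

(** * Misclassification *)

(** Under the second alternative [x] and [x'] lie on the same side of [y]. A misclassification thus
    leaves the first one, and [y] separates [x] from [x'], so [x] is at least as close to [y] as to
    [x']. *)
Lemma misclassified_near (R : realFieldType) (x x' y e : R) :
  `|x - x'| <= e \/ `|x - x'| < `|x' - y| ->
  (x <= y) != (x' <= y) -> `|x - y| <= e.
Proof.
have [xy|xy] := leP x y; have [x'y|x'y] := leP x' y => //= h _.
- rewrite ler0_norm ?subr_le0//; case: h; rewrite ler0_norm ?subr_le0; try lra.
  by rewrite gtr0_norm ?subr_gt0//; lra.
- rewrite gtr0_norm ?subr_gt0//; case: h; rewrite gtr0_norm ?subr_gt0; try lra.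
  by rewrite ler0_norm ?subr_le0//; lra.
Qed.

Lemma probability_dist_le d (T : measurableType d) (R : realType)
    (P : probability T R) (A B G : set T) :
  measurable A -> measurable B -> measurable G ->
  A `<=` B `|` G -> B `<=` A `|` G ->
  `|fine (P A) - fine (P B)| <= fine (P G).
Proof.
have half A' B' : measurable A' -> measurable B' -> measurable G ->
    A' `<=` B' `|` G -> fine (P A') <= fine (P B') + fine (P G).
  move=> mA mB mG sub.
  rewrite -fineD ?fin_num_measure// fine_le ?fin_numD ?fin_num_measure//.
  apply: le_trans (measureU2 _ _ _) => //.
  by apply: le_measure; rewrite ?inE//; exact: measurableU.
move=> mA mB mG AB BA; rewrite ler_distl.
by rewrite lerBlDr !half.
Qed.

Theorem theorem10 (R : realType) (d : measure_display) (T : measurableType d)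
    (P : probability T R) (X : {RV P >-> R}) (y gamma q : R)
    (Xs : nat -> {RV P >-> R}) (C_L : R)
    (Q := failure X y)
    (Xl := refine_approx gamma y (fun j => Xs j : T -> R))
    (Ql := fun l => failure (Xl l) y)
    (CQ := expected_refine_cost P gamma q y (fun j => Xs j : T -> R)) :
  0 < gamma -> gamma < 1 ->
  (forall j w, `|X w - Xs j w| <= gamma ^+ j) ->
  (forall x x' : R, (`|cdf X x - cdf X x'| <= (C_L * `|x - x'|)%:E)%E) ->
  (forall l w, `|X w - Xl l w| <= gamma ^+ l \/
               `|X w - Xl l w| < `|Xl l w - y|) ->
  exists C : R, forall eps : R, 0 < eps -> eps < expR (-1) ->
    exists (L : nat) (N : nat -> nat),
      [/\ (forall l, (l <= L)%N -> (0 < N l)%N),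
          (forall (d' : measure_display) (S : measurableType d')
             (PS : probability S R) (omega : nat -> nat -> {mfun S >-> T}),
             ml_samples PS P L N omega ->
             (rmse PS (ml_estimator Ql L N (fun l i => omega l i : S -> T))
                (fine 'E_P[Q]) < eps%:E)%E)
        & (ml_cost CQ L N <= (C * cost_rate q eps)%:E)%E].
Proof.
move=> g0 g1 hX lip hsel.
have C0 : 0 <= C_L.
  have := le_trans (abse_ge0 _) (lip 1 0).
  by rewrite lee_fin subr0 normr1 mulr1.
(* Raising q to 3/2 leaves cost_rate unchanged and makes the cost of a run
   geometric in its level. *)
pose q' := Num.max q (3 / 2).
have qq' : q <= q' by rewrite le_max lexx.
have q'1 : 1 < q' by rewrite lt_max; apply/orP; right; lra.
have rateE eps : cost_rate q' eps = cost_rate q eps.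
  rewrite /cost_rate /q'; case: (leP (3 / 2) q) => h //.
  by rewrite !ifT//; lra.
pose rho := gamma `^ (1 - q').
have rho1 : 1 < rho.
  rewrite /rho -opprB powRN -invf_lt1 ?invrK ?invr_gt0 ?powR_gt0//.
  by rewrite powR_lt1// subr_gt0.
have rho0 : 0 < rho by exact: lt_trans rho1.
pose K1 := 1 + 6 * C_L / gamma.
have K11 : 1 <= K1 by rewrite lerDl divr_ge0 ?mulr_ge0// ltW.
pose D := (1 - rho^-1)^-1.
have D1 : 1 <= D.
  have r' : 0 < rho^-1 < 1 by rewrite invr_gt0 rho0 invf_lt1.
  by rewrite /D invf_ge1; lra.
(* A single constant for bias, variance and cost: [K1 * D] bounds the cost of one run relative to
   [rho ^+ l], and the factor 2 pays for the two runs in a level difference. *)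
pose K := 2 * K1 * D.
have K1K : K1 <= K.
  rewrite /K -mulrA mulrCA ler_peMr ?(le_trans ler01)//; lra.
have K1' : 1 <= K by exact: le_trans K1K.
pose A l : set T := [set w | Xl l w <= y].
have mA l : measurable (A l) by exact: measurable_refine_approx_le.
pose B : set T := [set w | X w <= y].
have mB : measurable B.
  have -> : B = X @^-1` `]-oo, y]
    by apply/seteqP; split => w; rewrite /= in_itv.
  exact: measurable_funPTI.
pose near_y l : set T := [set w | `|X w - y| <= gamma ^+ l].
have mnear l : measurable (near_y l) by exact: measurable_near.
have Pnear l : fine (P (near_y l)) <= 3 * C_L * gamma ^+ l.
  rewrite -lee_fin fineK ?fin_num_measure//.
  by apply: probability_near_le => //; exact: exprn_gt0.
have misA l w : ((X w <= y) != (Xl l w <= y)) -> near_y l w.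
  by apply: misclassified_near; exact: hsel.
have near_sub k l : (l <= k)%N -> near_y k `<=` near_y l.
  by move=> lk w /le_trans; apply; rewrite ler_wiXn2l// ltW.
have memA l w : (w \in A l) = (Xl l w <= y).
  by apply/idP/idP => [/set_mem|/mem_set].
(* Away from [near_y k], levels [k] and [k.+1] both classify as [X] does. Level 0 is compared with
   0, so the whole space is taken, with probability [1 = gamma ^+ 0]. *)
pose G l := if l is k.+1 then near_y k else setT.
have mG l : measurable (G l) by case: l => [|l] //=; exact: mnear.
have PG l : fine (P (G l)) <= K * gamma ^+ l.
  apply: (@le_trans _ _ (K1 * gamma ^+ l)); last first.
    by rewrite ler_wpM2r ?exprn_ge0 ?(ltW g0).
  case: l => [|l] /=; first by rewrite probability_setT expr0 mulr1.
  apply: le_trans (Pnear l) _.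
  have -> : 3 * C_L * gamma ^+ l = 3 * C_L / gamma * gamma ^+ l.+1.
    by rewrite exprS; field; rewrite gt_eqF.
  rewrite ler_wpM2r ?exprn_ge0 ?(ltW g0)// /K1.
  have : 0 <= C_L / gamma by rewrite divr_ge0// ltW.
  by rewrite -!mulrA; lra.
have DG l w : level_difference (fun l => \1_(A l)) l w ^+ 2 <= \1_(G l) w :> R.
  case: l => [|l] /=.
    by rewrite !indicE in_setT; case: (w \in A 0%N); rewrite ?expr0n ?expr1n.
  have [wG|wG] := boolP (w \in near_y l).
    rewrite !indicE wG; case: (w \in A l.+1); case: (w \in A l);
    by rewrite ?subrr ?subr0 ?sub0r ?sqrrN ?expr0n ?expr1n.
  have sameA k : (l <= k)%N -> (w \in A k) = (X w <= y).
    move=> lk; rewrite memA; apply/eqP; apply: contraNT wG; rewrite eq_sym.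
    by move=> /misA /(near_sub _ _ lk) /mem_set.
  by rewrite !indicE !sameA// subrr expr0n.
have [C hC] := sample_sizes g0 g1 q'1 K1'.
exists C => eps e0 e1; have [L [N [N0 hL hV hN]]] := hC _ e0 e1.
exists L, N; split=> [//|d' S PS omega samples|].
- have N0' l : (l <= L)%N -> (0 < N l)%N by [].
  have mse := @ml_estimator_mse_le _ _ S T R PS P A G L N omega (fine 'E_P[Q])
    mA mG DG N0' samples.
  have EQ : 'E_P[Q]%E = P B by rewrite expectation_indic.
  have bias : `|fine (P (A L)) - fine (P B)| <= eps / 2.
    apply: le_trans (probability_dist_le P (mA L) mB (mnear L) _ _) _.
    - move=> w wA; have [wB|wB] := boolP (X w <= y); [by left|right].
      by apply: misA; rewrite (negbTE wB) (_ : Xl L w <= y).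
    - move=> w wB; have [wA|wA] := boolP (Xl L w <= y); [by left|right].
      by apply: misA; rewrite (negbTE wA) (_ : X w <= y).
    - apply: le_trans (Pnear L) (le_trans _ hL).
      rewrite ler_wpM2r ?exprn_ge0 ?(ltW g0)// (le_trans _ K1K)// /K1 -mulrA.
      have : C_L <= C_L / gamma by rewrite ler_peMr// invf_ge1// ltW.
      by lra.
  have hVG : \sum_(l < L.+1) fine (P (G l)) / (N l)%:R <= eps ^+ 2 / 2.
    by apply: le_trans hV; apply: ler_sum => l _; rewrite ler_wpM2r.
  have hb : (fine (P (A L)) - fine (P B)) ^+ 2 <= (eps / 2) ^+ 2.
    by rewrite -real_normK ?num_real// ler_sqr ?nnegrE// divr_ge0// ltW.
  have e20 : 0 < eps ^+ 2 by exact: exprn_gt0.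
  (* Variance [eps ^+ 2 / 2] plus squared bias [eps ^+ 2 / 4] stays below [eps ^+ 2], which makes
     the error bound strict. *)
  rewrite /rmse. apply: (@le_lt_trans _ _ (sqrte (3 / 4 * eps ^+ 2)%:E)).
    rewrite lee_sqrt; last by rewrite lee_fin; lra.
    apply: le_trans mse _; rewrite lee_fin EQ.
    by apply: le_trans (lerD hVG hb) _; rewrite expr_div_n; lra.
  rewrite /= lte_fin -[ltRHS]ger0_norm ?(ltW e0)// -sqrtr_sqr ltr_sqrt//.
  by lra.
- rewrite -rateE; apply: le_trans (_ :
    (_ <= (\sum_(l < L.+1) (N l)%:R * (K * rho ^+ l))%:E)%E) _; last first.
    by rewrite lee_fin.
  rewrite -sumEFin; apply: lee_sum => l _.
  rewrite EFinM lee_wpmul2l ?lee_fin//.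
  have cost k : (CQ k <= (K1 * (D * rho ^+ k))%:E)%E.
    apply: le_trans (expected_refine_cost_le _ _ g0 g1 qq' hX lip C0) _.
    rewrite lee_fin ler_wpM2l ?(le_trans ler01)//.
    exact: geometric_sum_gt1_le.
  have K1D : 0 <= K1 * D by rewrite mulr_ge0 ?(le_trans ler01).
  have KE k : K * rho ^+ k = K1 * (D * rho ^+ k) + K1 * (D * rho ^+ k).
    by rewrite /K; ring.
  (* One half of [K * rho ^+ l] pays for each run; at level 0 the second half is slack, and above it
     the coarser run is covered since [rho > 1]. *)
  rewrite KE EFinD; case: (nat_of_ord l) => [|k] /=.
    apply: le_trans (cost 0%N) _; rewrite leeDl// lee_fin.
    by rewrite mulrA mulr_ge0// exprn_ge0// ltW.
  rewrite leeD//; apply: le_trans (cost k) _; rewrite lee_fin !mulrA.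
  by rewrite ler_wpM2l// ler_eXn2l// ltnW.
Qed.
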